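(* Let $d\in\mathbb{N}$ and let $\varphi\colon(0,1)\to[0,d]$ be an arbitrary function. Then the following are equivalent: (a) There exists a set $F\subset\mathbb{R}^d$ such that $\overline{\dim}_{\mathrm{A}}^{\theta}F=\varphi(\theta)$ for all $\theta\in(0,1)$. (b) $\varphi$ is increasing and $\theta\mapsto(1-\theta)\varphi(\theta)$ is decreasing on $(0,1)$. (c) $\varphi$ is the (pointwise) supremum of a family of functions of the form $\theta\mapsto f(\theta)/(1-\theta)$ where $$f(\theta)=\begin{cases}\kappa(1-c) &: 0<\theta\leq c\\ \kappa(1-\theta) &: c<\theta<1\end{cases}$$ for $c\in(0,1)$ and $\kappa\in[0,d]$.
   Context: ''Increasing'' and ''decreasing'' are meant in the non-strict sense; families in (c) are non-empty. $\mathbb{R}^d$ carries the Euclidean norm and $B(x,\delta)$ is the open ball of centre $x$ and radius $\delta$. For bounded $E\subset\mathbb{R}^d$ and $\delta>0$, $N_\delta(E)$ is the least number of balls of radius $\delta$ required to cover $E$. For $\theta\in(0,1)$ the upper Assouad spectrum of $F\subset\mathbb{R}^d$ is $$\overline{\dim}_{\mathrm{A}}^{\theta}F=\inf\Bigl\{\alpha:(\exists C>0)(\forall\, 0<\delta\leq 1)(\forall\, 0<\delta'\leq\delta^{1/\theta})(\forall x\in F)\ N_{\delta'}(F\cap B(x,\delta))\leq C\Bigl(\frac{\delta}{\delta'}\Bigr)^{\alpha}\Bigr\}.$$ *)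

(* Defs.v *)
From mathcomp Require Import all_boot all_order all_algebra.
From mathcomp Require Import all_classical all_reals all_analysis.

Set Implicit Arguments.
Unset Strict Implicit.
Unset Printing Implicit Defensive.

Import Order.TTheory GRing.Theory Num.Theory.

Local Open Scope classical_set_scope.
Local Open Scope ring_scope.

(* The library's norm on row vectors is the sup norm, hence the Euclidean norm
   and its balls are defined here. *)
Definition enorm (R : realType) (d : nat) (x : 'rV[R]_d) : R :=
  Num.sqrt (\sum_(i < d) x ord0 i ^+ 2).

Definition eball (R : realType) (d : nat) (x : 'rV[R]_d) (r : R) :
    set 'rV[R]_d :=
  [set y | enorm (y - x) < r].

(* The centres of the covering balls may be any points of the space. *)
Definition covered_by (R : realType) (d : nat) (delta : R)
    (E : set 'rV[R]_d) (n : nat) : Prop :=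
  exists c : 'I_n -> 'rV[R]_d, E `<=` \bigcup_i eball (c i) delta.

(* For bounded [E] and [0 < delta] this infimum is attained, so it is the least
   number of balls; it is [+oo] when no finite family of balls covers [E]. *)
Definition covering_number (R : realType) (d : nat) (delta : R)
    (E : set 'rV[R]_d) : \bar R :=
  ereal_inf [set (n%:R)%:E | n in [set n | covered_by delta E n]].

(* The infimum is taken in the extended reals over all real exponents, so the
   empty set has spectrum [-oo]. *)
Definition upper_assouad_spectrum (R : realType) (d : nat) (theta : R)
    (F : set 'rV[R]_d) : \bar R :=
  ereal_inf [set alpha%:E | alpha in [set alpha : R |
    exists2 C : R, 0 < C &
      forall delta : R, 0 < delta <= 1 ->
      forall delta' : R, 0 < delta' <= delta `^ (theta^-1) ->
      forall x : 'rV[R]_d, F x ->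
        (covering_number delta' (F `&` eball x delta)
           <= (C * (delta / delta') `^ alpha)%:E)%E]].

Definition profile (R : realType) (c kappa theta : R) : R :=
  if theta <= c then kappa * (1 - c) else kappa * (1 - theta).

(* Main.v *)
Require Import Defs.
From mathcomp Require Import all_boot all_order all_algebra.
From mathcomp Require Import all_classical all_reals all_analysis.
From mathcomp Require Import zify ring lra.

Set Implicit Arguments.
Unset Strict Implicit.
Unset Printing Implicit Defensive.

Import Order.TTheory GRing.Theory Num.Theory.

Local Open Scope classical_set_scope.
Local Open Scope ring_scope.

(* An increasing [phi] with decreasing [(1 - theta) * phi theta] is the supremum
   of the profiles with break [s] and [kappa = phi s], and it is realized by a
   union of finite pieces lying far apart.  The piece with parameters [p, L >= 1]
   is a [d]-fold product of sets of integers [n < 2 ^ L], scaled by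
   [rho = 2 ^- (p + L)], whose binary digits are allowed to be nonzero only at
   positions of density [kappa / d].  Between the scales [rho] and
   [2 ^- p = rho ^ c], where [c = p / (p + L)], it looks [kappa]-dimensional, and
   outside this range it is trivial, so its profile has break [c]; one takes
   [kappa = phi c].  Constants depend on [d] only, so the union admits the
   exponent [phi theta].  The pieces with [p = floor (N * theta)] and [p + L = N],
   [N --> oo], show that no smaller exponent is possible. *)

(** * Admissible exponents: (a) implies (b) *)

Definition spectrum_exponent (R : realType) (d : nat) (theta : R)
    (F : set 'rV[R]_d) (alpha : R) : Prop :=
  exists2 C : R, 0 < C &
    forall delta : R, 0 < delta <= 1 ->
    forall delta' : R, 0 < delta' <= delta `^ (theta^-1) ->
    forall x : 'rV[R]_d, F x ->
      (covering_number delta' (F `&` eball x delta)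
         <= (C * (delta / delta') `^ alpha)%:E)%E.

Lemma covering_number_sub (R : realType) (d : nat) (r : R)
    (A B : set 'rV[R]_d) :
  A `<=` B -> (covering_number r A <= covering_number r B)%E.
Proof.
move=> AB; apply: ereal_inf_le_tmp => _ [n [c Bc] <-]; exists n => //.
by exists c; apply: subset_trans AB Bc.
Qed.

Lemma powR_theta_le (R : realType) (theta delta delta' : R) :
  0 < theta -> 0 < delta -> 0 < delta' <= delta `^ (theta^-1) ->
  delta' `^ theta <= delta.
Proof.
move=> t0 d0 /andP[d'0 le].
have := ge0_ler_powR (ltW t0) _ _ le.
rewrite -powRrM mulVf ?gt_eqF // powRr1 ?(ltW d0) //; apply.
- by rewrite nnegrE ltW.
- by rewrite nnegrE powR_ge0.
Qed.

Lemma powR_theta_inv_le (R : realType) (theta delta delta' : R) :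
  0 < theta -> 0 < delta -> 0 < delta' -> delta' `^ theta <= delta ->
  delta' <= delta `^ (theta^-1).
Proof.
move=> t0 d0 d'0 le.
have t'0 : 0 <= theta^-1 by rewrite invr_ge0 ltW.
have := ge0_ler_powR t'0 _ _ le.
rewrite -powRrM mulfV ?gt_eqF // powRr1 ?(ltW d'0) //; apply.
- by rewrite nnegrE powR_ge0.
- by rewrite nnegrE ltW.
Qed.

Lemma powR_le1 (R : realType) (a x : R) : 0 < a <= 1 -> 0 <= x -> a `^ x <= 1.
Proof.
move=> /andP[a0 a1] x0; have := ge0_ler_powR x0 _ _ a1.
by rewrite powR1; apply; rewrite nnegrE ?ltW.
Qed.

(** Since [delta <= 1], the constraint on [delta'] is stronger for [s] than for [t]. *)
Lemma spectrum_exponent_le (R : realType) (d : nat) (s t : R)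
    (F : set 'rV[R]_d) (alpha : R) :
  0 < s -> s <= t -> spectrum_exponent t F alpha -> spectrum_exponent s F alpha.
Proof.
move=> s0 st [C C0 H]; exists C => // delta d01 delta' /andP[d'0 d'le] x Fx.
apply: H => //; rewrite d'0 /=; apply: le_trans d'le _.
by apply: ger_powR => //; rewrite lef_pV2 // posrE // (lt_le_trans s0).
Qed.

(* When [delta' > delta `^ s^-1] the small ball is enlarged to radius
   [delta' `^ s], the borderline radius for [s]. *)
Lemma spectrum_exponent_ge (R : realType) (d : nat) (s t : R)
    (F : set 'rV[R]_d) (alpha : R) :
  0 < s < 1 -> 0 < t < 1 -> s <= t -> 0 <= alpha ->
  spectrum_exponent s F alpha ->
  spectrum_exponent t F (alpha * (1 - s) / (1 - t)).
Proof.
move=> /andP[s0 s1] /andP[t0 t1] st a0 [C C0 H]; exists C => // delta d01.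
have /andP[d0 d1] := d01.
move=> delta' d'le x Fx; have /andP[d'0 _] := d'le.
have d't := powR_theta_le t0 d0 d'le.
have d'd : delta' <= delta.
  apply: le_trans d't; rewrite -[X in X <= _]powRr1 ?(ltW d'0) //.
  have d'1 : delta' <= 1.
    have /andP[_ /le_trans] := d'le; apply.
    by apply: powR_le1 => //; rewrite invr_ge0 ltW.
  by apply: ger_powR; rewrite ?d'0 // ltW.
have d'1 := le_trans d'd d1.
have r1 : 1 <= delta / delta' by rewrite ler_pdivlMr // mul1r.
(* In the first case the pair is already admissible for [s], and the larger exponent only weakens
   the bound because [delta / delta' >= 1]. *)
have [le|lt] := leP (delta' `^ s) delta.
  apply: le_trans (H _ d01 delta' _ x Fx) _.
    by rewrite d'0 powR_theta_inv_le.
  rewrite lee_fin ler_pM2l //; apply: ler_powR => //.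
  rewrite ler_pdivlMr ?subr_gt0 //; nra.
apply: le_trans (covering_number_sub delta' (B := F `&` eball x (delta' `^ s)) _) _.
  by move=> y [Fy /= xy]; split => //=; apply: lt_trans lt.
have d's : 0 < delta' `^ s <= 1 by rewrite powR_gt0 //= powR_le1 ?d'0 // ltW.
apply: le_trans (H _ d's delta' _ x Fx) _.
  by rewrite d'0 powR_theta_inv_le // powR_gt0.
rewrite lee_fin ler_pM2l //.
have d'n : delta' != 0 by rewrite gt_eqF.
have E u : delta' `^ u / delta' = (delta'^-1) `^ (1 - u).
  rewrite -[in RHS]powR_inv1 ?(ltW d'0) // -powRrM -[X in _ / X]powRr1 ?(ltW d'0) //.
  by rewrite -powRB ?d'n ?implybT //; congr (_ `^ _); ring.
rewrite E -powRrM.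
(* The new exponent is the one for which its power of [delta' ^ t / delta'] equals the power [alpha]
   of [delta' ^ s / delta']; then [delta' ^ t <= delta] finishes. *)
have -> : (1 - s) * alpha = (1 - t) * (alpha * (1 - s) / (1 - t)).
  by field; rewrite subr_eq0 eq_sym lt_eqF.
rewrite [leLHS]powRrM -E; apply: ge0_ler_powR.
- by rewrite divr_ge0 ?mulr_ge0 // subr_ge0 ltW.
- by rewrite nnegrE divr_ge0 ?powR_ge0 // ltW.
- by rewrite nnegrE divr_ge0 // ltW.
by rewrite ler_pM2r ?invr_gt0.
Qed.

Lemma spectrum_monotone (R : realType) (d : nat) (phi : R -> R)
    (phi_ge0 : forall theta : R, 0 < theta < 1 -> 0 <= phi theta)
    (F : set 'rV[R]_d)
    (HF : forall theta : R, 0 < theta < 1 ->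
      upper_assouad_spectrum theta F = (phi theta)%:E) :
  (forall s t : R, 0 < s < 1 -> 0 < t < 1 -> s <= t -> phi s <= phi t) /\
  (forall s t : R, 0 < s < 1 -> 0 < t < 1 -> s <= t ->
    (1 - t) * phi t <= (1 - s) * phi s).
Proof.
have lb t a : 0 < t < 1 -> spectrum_exponent t F a -> phi t <= a.
  move=> t01 ta; rewrite -lee_fin -HF //; apply: ereal_inf_lbound.
  by exists a.
split=> s t s01 t01 st; have /andP[s0 s1] := s01; have /andP[t0 t1] := t01.
  rewrite -lee_fin -(HF t) //; apply: le_ereal_inf_tmp => _ [a ta <-].
  by rewrite lee_fin; apply: lb => //; apply: spectrum_exponent_le st ta.
rewrite -ler_pdivrMl ?subr_gt0 //.
rewrite -lee_fin -(HF s) //; apply: le_ereal_inf_tmp => _ [a sa <-]; rewrite lee_fin.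
have a0 : 0 <= a by apply: le_trans (lb _ _ s01 sa); apply: phi_ge0.
have := lb _ _ t01 (spectrum_exponent_ge s01 t01 st a0 sa).
by rewrite ler_pdivlMr ?subr_gt0 // ler_pdivrMl ?subr_gt0 // mulrC [_ * a]mulrC.
Qed.

(** * Profiles and their suprema: (b) and (c) are equivalent *)

Lemma profile_sup (R : realType) (d : nat) (phi : R -> R)
    (phi_range : forall theta : R, 0 < theta < 1 -> 0 <= phi theta <= d%:R) :
  (forall s t : R, 0 < s < 1 -> 0 < t < 1 -> s <= t -> phi s <= phi t) /\
  (forall s t : R, 0 < s < 1 -> 0 < t < 1 -> s <= t ->
    (1 - t) * phi t <= (1 - s) * phi s) ->
  exists G : set (R -> R),
    [/\ G !=set0,
        forall g, G g -> exists c kappa : R,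
          [/\ 0 < c < 1, 0 <= kappa <= d%:R &
              forall theta : R, 0 < theta < 1 ->
                g theta = profile c kappa theta / (1 - theta)] &
        forall theta : R, 0 < theta < 1 ->
          (phi theta)%:E = ereal_sup [set (g theta)%:E | g in G]].
Proof.
move=> [phi_incr phi_decr].
(* The member for [s] touches [phi] at [s]. To the left it stays below [phi] because
   [(1 - theta) * phi theta] decreases, to the right because [phi] increases. *)
pose g s := fun theta : R => profile s (phi s) theta / (1 - theta).
exists (g @` [set s | 0 < s < 1]); split.
- by exists (g 2^-1); exists 2^-1 => //=; lra.
- by move=> _ [s /= s01 <-]; exists s, (phi s); split => //; apply: phi_range.
move=> t t01; have /andP[t0 t1] := t01; apply/eqP; rewrite eq_le; apply/andP; split.
  apply: ereal_sup_ubound; exists (g t); first by exists t.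
  by rewrite /g /profile lexx mulfK // gt_eqF // subr_gt0.
apply: ge_ereal_sup => _ [_ [s /= s01 <-] <-]; rewrite lee_fin /g /profile.
rewrite ler_pdivrMr ?subr_gt0 //; case: (leP t s) => ts.
  by rewrite mulrC [leRHS]mulrC; apply: phi_decr.
by rewrite ler_pM2r ?subr_gt0 //; apply: phi_incr => //; apply: ltW.
Qed.

(** [profile c kappa t] is [kappa * (1 - max c t)], so the quotient is [kappa] times the minimum of
    [1] and [(1 - c) / (1 - t)]. *)
Lemma profile_incr (R : realType) (c kappa s t : R) :
  0 < c < 1 -> 0 <= kappa -> s < 1 -> t < 1 -> s <= t ->
  profile c kappa s / (1 - s) <= profile c kappa t / (1 - t).
Proof.
move=> /andP[c0 c1] k0 s1 t1 st.
rewrite ler_pdivrMr ?subr_gt0 // mulrAC ler_pdivlMr ?subr_gt0 // /profile.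
by case: (leP s c) => sc; case: (leP t c) => tc; rewrite -!mulrA ler_wpM2l //; nra.
Qed.

Lemma profile_decr (R : realType) (c kappa s t : R) :
  0 <= kappa -> s <= t -> profile c kappa t <= profile c kappa s.
Proof.
move=> k0 st; rewrite /profile.
by case: (leP t c) => tc; case: (leP s c) => sc; rewrite ler_wpM2l //; lra.
Qed.

(** Both properties pass from the members to the supremum; for the second,
    [(1 - s) * phi s / (1 - t)] bounds every member at [t]. *)
Lemma profile_sup_monotone (R : realType) (d : nat) (phi : R -> R)
    (G : set (R -> R))
    (G_profile : forall g, G g -> exists c kappa : R,
      [/\ 0 < c < 1, 0 <= kappa <= d%:R &
          forall theta : R, 0 < theta < 1 ->
            g theta = profile c kappa theta / (1 - theta)])
    (phi_sup : forall theta : R, 0 < theta < 1 ->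
      (phi theta)%:E = ereal_sup [set (g theta)%:E | g in G]) :
  (forall s t : R, 0 < s < 1 -> 0 < t < 1 -> s <= t -> phi s <= phi t) /\
  (forall s t : R, 0 < s < 1 -> 0 < t < 1 -> s <= t ->
    (1 - t) * phi t <= (1 - s) * phi s).
Proof.
have ub g t : G g -> 0 < t < 1 -> g t <= phi t.
  by move=> Gg t01; rewrite -lee_fin phi_sup //; apply: ereal_sup_ubound; exists g.
split=> s t s01 t01 st; have /andP[s0 s1] := s01; have /andP[t0 t1] := t01.
  rewrite -lee_fin (phi_sup s) //; apply: ge_ereal_sup => _ [g Gg <-].
  rewrite lee_fin; apply: le_trans (ub _ _ Gg t01).
  have [c [k [c01 /andP[k0 _] gE]]] := G_profile _ Gg.
  by rewrite !gE //; apply: profile_incr.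
rewrite mulrC -ler_pdivlMr ?subr_gt0 //.
rewrite -lee_fin (phi_sup t) //; apply: ge_ereal_sup => _ [g Gg <-].
rewrite lee_fin ler_pdivlMr ?subr_gt0 // [leLHS]mulrC.
apply: (@le_trans _ _ ((1 - s) * g s)); last by rewrite ler_pM2l ?subr_gt0 // ub.
have [c [k [c01 /andP[k0 _] gE]]] := G_profile _ Gg.
rewrite !gE // [leLHS]mulrC [leRHS]mulrC !divfK ?gt_eqF ?subr_gt0 //.
exact: profile_decr.
Qed.

(** * Binary expansions with restricted digit positions *)

Local Open Scope nat_scope.

(** [odd (n %/ 2 ^ i)] is the binary digit of [n] at position [i]. *)
Definition digits_in (J : pred nat) (n : nat) : Prop :=
  forall i, odd (n %/ 2 ^ i) -> J i.

(** Enumerates the numbers below [2 ^ j] with digits in [J]; once the digit at position [0] is split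
    off, the others obey the shifted predicate. *)
Fixpoint numerals (J : pred nat) (j : nat) : seq nat :=
  if j is j'.+1 then
    let s := numerals (J \o succn) j' in
    [seq m.*2 | m <- s] ++ (if J 0 then [seq m.*2.+1 | m <- s] else [::])
  else [:: 0].

Lemma digits_in0 (J : pred nat) : digits_in J 0.
Proof. by move=> i; rewrite div0n. Qed.

Lemma digits_in_div (J : pred nat) (l n : nat) :
  digits_in J n -> digits_in (fun i => J (l + i)) (n %/ 2 ^ l).
Proof. by move=> Jn i; rewrite -divnMA -expnD => /Jn. Qed.

Lemma mem_numerals (J : pred nat) (j n : nat) :
  digits_in J n -> n %% 2 ^ j \in numerals J j.
Proof.
elim: j J n => [|j IHj] J n Jn; first by rewrite modn1.
have Jh : digits_in (J \o succn) n./2.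
  by rewrite -divn2 -[X in _ %/ X]expn1; apply: digits_in_div.
have En : n %% 2 ^ j.+1 = odd n + (n./2 %% 2 ^ j).*2.
  rewrite -{1}(odd_double_half n) expnS -!muln2 [2 * _]mulnC.
  rewrite -modnDmr -muln_modl modn_small //.
  have := ltn_pmod n./2 (expn_gt0 2 j); case: (odd n); lia.
rewrite /= mem_cat En; case: (boolP (odd n)) => on.
  have -> : J 0 by apply: Jn; rewrite divn1.
  by apply/orP; right; apply/mapP; exists (n./2 %% 2 ^ j); first exact: IHj.
by apply/orP; left; apply/mapP; exists (n./2 %% 2 ^ j); first exact: IHj.
Qed.

Lemma numerals_digits_in (J : pred nat) (j n : nat) :
  n \in numerals J j -> n < 2 ^ j /\ digits_in J n.
Proof.
elim: j J n => [|j IHj] J n /=.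
  by rewrite inE => /eqP ->; split=> // i; rewrite div0n.
have step (e : bool) m : m \in numerals (J \o succn) j -> (e -> J 0) ->
    e + m.*2 < 2 ^ j.+1 /\ digits_in J (e + m.*2).
  move=> /IHj[mlt Jm] J0; split; first by rewrite expnS; case: e {J0}; lia.
  case=> [|i]; first by rewrite divn1 oddD odd_double addbF oddb.
  by rewrite expnS divnMA divn2 half_bit_double => /Jm.
rewrite mem_cat => /orP[/mapP[m mS ->]|].
  exact: (step false).
by case: ifP => // J0 /mapP[m mS ->]; apply: (step true).
Qed.

Lemma numerals_uniq (J : pred nat) (j : nat) : uniq (numerals J j).
Proof.
elim: j J => [//|j IHj] J /=; rewrite cat_uniq map_inj_uniq ?IHj //=; last first.
  exact: double_inj.
case: (J 0) => //=; rewrite map_inj_uniq ?IHj ?andbT //; last first.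
  by move=> m n [] /double_inj.
apply/hasPn => _ /mapP[m _ ->]; apply/negP => /mapP[n _ /(congr1 odd)].
by rewrite /= !odd_double.
Qed.

Lemma size_numerals (J : pred nat) (j : nat) :
  size (numerals J j) = 2 ^ \sum_(i < j) J i.
Proof.
elim: j J => [|j IHj] J; first by rewrite big_ord0.
rewrite big_ord_recl /= size_cat size_map IHj expnD.
case: (J 0) => /=; last by rewrite addn0 mul1n.
by rewrite size_map IHj addnn -mul2n.
Qed.

Local Open Scope ring_scope.

(** * Euclidean norm and covering numbers *)

Lemma enorm_coord (R : realType) (d : nat) (x : 'rV[R]_d) (i : 'I_d) :
  `|x ord0 i| <= enorm x.
Proof.
rewrite -sqrtr_sqr ler_sqrt ?sumr_ge0 // => [|j _]; last exact: sqr_ge0.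
by rewrite (bigD1 i) //= lerDl sumr_ge0 // => j _; exact: sqr_ge0.
Qed.

(* The factor [d.+1] rather than [d] keeps the inequality strict for [d = 0]. *)
Lemma enorm_lt (R : realType) (d : nat) (x : 'rV[R]_d) (r : R) :
  0 < r -> (forall i, `|x ord0 i| <= r) -> enorm x < d.+1%:R * r.
Proof.
move=> r0 xr; have D0 : 0 < d.+1%:R * r by rewrite mulr_gt0.
rewrite -(ger0_norm (ltW D0)) -sqrtr_sqr ltr_sqrt ?exprn_gt0 //.
apply: (@le_lt_trans _ _ (\sum_(i < d) r ^+ 2)).
  by apply: ler_sum => i _; rewrite -real_normK ?num_real // lerXn2r ?nnegrE // ltW.
rewrite sumr_const card_ord -[ltLHS]mulr_natl exprMn ltr_pM2r ?exprn_gt0 //.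
by rewrite -natrX ltr_nat; lia.
Qed.

Lemma covered_by_finite (R : realType) (d : nat) (T : finType) (r : R)
    (A : set 'rV[R]_d) (c : T -> 'rV[R]_d) :
  (forall y, A y -> exists t, eball (c t) r y) -> Defs.covered_by r A #|T|.
Proof.
move=> Ac; exists (fun i => c (enum_val i)) => y /Ac[t ty].
by exists (enum_rank t) => //=; rewrite enum_rankK.
Qed.

Lemma covering_number_le (R : realType) (d : nat) (r : R)
    (A : set 'rV[R]_d) (n : nat) (K : R) :
  Defs.covered_by r A n -> n%:R <= K -> (covering_number r A <= K%:E)%E.
Proof.
move=> An nK; apply: (@le_trans _ _ (n%:R)%:E); last by rewrite lee_fin.
by apply: ereal_inf_lbound; exists n.
Qed.

(** By pigeonhole: no ball holds two of the points, so assigning to each point a ball that holds it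
    is injective. *)
Lemma covering_number_ge (R : realType) (d : nat) (T : finType) (r : R)
    (A : set 'rV[R]_d) (f : T -> 'rV[R]_d) :
  (forall t, A (f t)) ->
  (forall t u c, eball c r (f t) -> eball c r (f u) -> t = u) ->
  ((#|T|%:R)%:E <= covering_number r A)%E.
Proof.
move=> Af sep; apply: le_ereal_inf_tmp => _ [n [c Ac] <-].
rewrite lee_fin ler_nat.
have /choice[g gP] : forall t, exists i, eball (c i) r (f t).
  by move=> t; have [i _ ?] := Ac _ (Af t); exists i.
rewrite -[n in leqRHS]card_ord; apply: (@leq_card _ _ g) => t u tu.
by apply: sep (gP t) _; rewrite tu.
Qed.

(** * Digit positions of prescribed density *)

Definition weight (R : realType) (beta : R) (j : nat) : nat :=
  Num.truncn (j%:R * beta).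

(* The digit positions of density [beta]: exactly [weight beta j] of the first
   [j] positions are active. *)
Definition active (R : realType) (beta : R) : pred nat :=
  fun i => (weight beta i < weight beta i.+1)%N.

(** As [beta <= 1], the floor of [j * beta] grows by at most 1 at each step. *)
Lemma weightS (R : realType) (beta : R) (j : nat) :
  0 <= beta <= 1 -> weight beta j.+1 = (active beta j + weight beta j)%N.
Proof.
move=> /andP[b0 b1]; have h k : 0 <= k%:R * beta by rewrite mulr_ge0.
rewrite /active; have : (weight beta j <= weight beta j.+1 <= (weight beta j).+1)%N.
  apply/andP; split; first by apply: le_truncn; rewrite ler_wpM2r // ler_nat.
  rewrite -ltnS /weight truncn_lt_nat //.
  have /andP[_ wg] := truncn_itv (h j).
  by rewrite -[j.+1]addn1 -natr1 natrD; lra.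
by case: ltnP => /=; lia.
Qed.

Lemma size_numerals_active (R : realType) (beta : R) (l j : nat) :
  0 <= beta <= 1 ->
  size (numerals (fun i => active beta (l + i)) j)
    = (2 ^ (weight beta (l + j) - weight beta l))%N.
Proof.
move=> b01; rewrite size_numerals; congr (2 ^ _)%N.
elim: j => [|j IHj]; first by rewrite big_ord0 addn0 subnn.
have mono : (weight beta l <= weight beta (l + j))%N.
  case/andP: b01 => b0 _; apply: le_truncn.
  by rewrite ler_wpM2r // ler_nat leq_addr.
by rewrite big_ord_recr /= IHj addnS weightS // addnC addnBA.
Qed.

Lemma weight_sub_le (R : realType) (beta : R) (l j : nat) :
  0 <= beta -> (weight beta (l + j) - weight beta l)%:R <= j%:R * beta + 1.
Proof.
move=> b0; have h k : 0 <= k%:R * beta by rewrite mulr_ge0.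
have /andP[wl _] := truncn_itv (h (l + j)%N).
have /andP[_ wg] := truncn_itv (h l).
have mono : (weight beta l <= weight beta (l + j))%N.
  by apply: le_truncn; rewrite ler_wpM2r // ler_nat leq_addr.
rewrite natrB //; move: wl wg; rewrite -/(weight _ _) -/(weight _ _) natrD -natr1; lra.
Qed.

(** * Covering a single piece *)

Definition grid_point (R : realType) (d : nat) (b rho : R) (n : 'I_d -> nat) :
    'rV[R]_d :=
  \row_i (b + rho * (n i)%:R).

Definition piece (R : realType) (d : nat) (beta b rho : R) (L : nat) :
    set 'rV[R]_d :=
  [set y | exists2 n : 'I_d -> nat,
     forall i, (n i < 2 ^ L)%N /\ digits_in (active beta) (n i) &
     y = grid_point b rho n].

(* Only the digits between positions [l] and [k] matter: the digits below [l]
   are absorbed by the radius, and those above [k] take two values. *)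
Lemma covered_by_box (R : realType) (d : nat) (beta b rho r : R) (l j : nat)
    (a : 'I_d -> nat) (A : set 'rV[R]_d) :
  0 <= beta <= 1 -> 0 < rho -> 0 < r ->
  l = 0%N \/ d.+1%:R * (rho * 2 ^+ l) <= r ->
  (forall y, A y -> exists2 n : 'I_d -> nat,
     forall i, digits_in (active beta) (n i) /\
               (a i <= n i < a i + 2 ^ (l + j))%N
     & y = grid_point b rho n) ->
  Defs.covered_by r A (2 ^ (d * (weight beta (l + j) - weight beta l).+1)).
Proof.
move=> b01 rho0 r0 lr Abox.
pose S := numerals (fun i => active beta (l + i)) j.
(* A candidate for [n i %/ 2 ^ l]: [e.2] picks the digits from position [l] up to [l + j], excluded,
   and [e.1] one of the two aligned blocks of length [2 ^ (l + j)] that the window from [a i] can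
   meet. *)
pose h (i : 'I_d) (e : bool * 'I_(size S)) : nat :=
  ((a i %/ 2 ^ (l + j) + e.1) * 2 ^ j + nth 0%N S e.2)%N.
pose c (f : {ffun 'I_d -> bool * 'I_(size S)}) : 'rV[R]_d :=
  grid_point b rho (fun i => 2 ^ l * h i (f i))%N.
have -> : (2 ^ (d * (weight beta (l + j) - weight beta l).+1))%N =
    #|{: {ffun 'I_d -> bool * 'I_(size S)}}|.
  rewrite card_ffun card_prod card_bool !card_ord size_numerals_active //.
  by rewrite -expnS -expnM mulnC.
apply: (@covered_by_finite _ _ _ _ _ c) => y /Abox[n nP ->].
have /choice[f fP] : forall i, exists e, h i e = (n i %/ 2 ^ l)%N.
  move=> i; have [Jn /andP[an na]] := nP i.
  have mS : (n i %/ 2 ^ l %% 2 ^ j \in S)%N.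
    by apply: mem_numerals; apply: digits_in_div.
  have iS : (index (n i %/ 2 ^ l %% 2 ^ j) S < size S)%N by rewrite index_mem.
  have lo : (a i %/ 2 ^ (l + j) <= n i %/ 2 ^ (l + j))%N by apply: leq_div2r.
  have hi : (n i %/ 2 ^ (l + j) <= (a i %/ 2 ^ (l + j)).+1)%N.
    have <- : ((a i + 2 ^ (l + j)) %/ 2 ^ (l + j))%N = (a i %/ 2 ^ (l + j)).+1.
      by rewrite divnDr ?dvdnn // divnn expn_gt0 addn1.
    by rewrite leq_div2r // ltnW.
  exists ((a i %/ 2 ^ (l + j) < n i %/ 2 ^ (l + j))%N, Ordinal iS).
  rewrite /h /= nth_index // [in RHS](divn_eq (n i %/ 2 ^ l) (2 ^ j)).
  rewrite -divnMA -expnD; congr (_ * _ + _)%N.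
  by case: ltnP lo hi => /=; lia.
exists [ffun i => f i]; rewrite /eball /=.
have D0 : 0 < d.+1%:R :> R by [].
have dist i : (grid_point b rho n - c [ffun i => f i]) ord0 i
    = rho * (n i %% 2 ^ l)%:R.
  have nE : (n i)%:R = (2 ^ l * (n i %/ 2 ^ l))%:R + (n i %% 2 ^ l)%:R :> R.
    by rewrite -natrD mulnC -divn_eq.
  by rewrite !mxE ffunE fP nE opprD addrACA subrr add0r mulrDr addrC addKr.
(* At [l = 0] no digit is discarded: the centre is the point itself, and any positive radius will
   do. *)
case: lr => [l0|lr].
  suff -> : grid_point b rho n - c [ffun i => f i] = 0.
    by rewrite /enorm big1 ?sqrtr0 // => i _; rewrite mxE expr0n.
  by apply/rowP => i; rewrite dist l0 modn1 mulr0 mxE.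
apply: lt_le_trans lr; apply: enorm_lt => [|i]; first by rewrite mulr_gt0 ?exprn_gt0.
rewrite dist ger0_norm ?mulr_ge0 ?(ltW rho0) // ler_pM2l // -natrX ler_nat.
by rewrite ltnW // ltn_pmod // expn_gt0.
Qed.

Lemma pow2_between (R : realType) (y : R) :
  1 <= y -> exists j : nat, 2 ^+ j <= y < 2 ^+ j.+1.
Proof.
move=> y1; have y0 : 0 <= y by apply: le_trans y1.
have /andP[ty yt] := truncn_itv y0.
have t0 : (0 < Num.truncn y)%N by rewrite truncn_gt0.
have /andP[lo hi] := trunc_log_bounds (isT : (1 < 2)%N) t0.
exists (trunc_log 2 (Num.truncn y)); apply/andP; split.
  by apply: le_trans ty; rewrite -natrX ler_nat.
by apply: lt_le_trans yt _; rewrite -natrX ler_nat.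
Qed.

Lemma mulr_divd (R : realType) (d : nat) (kappa : R) :
  0 <= kappa <= d%:R -> d%:R * (kappa / d%:R) = kappa.
Proof.
case: d => [|d] k0d; last by rewrite mulrC divfK.
by rewrite mul0r; lra.
Qed.

Lemma divd_ge0_le1 (R : realType) (d : nat) (kappa : R) :
  0 <= kappa <= d%:R -> 0 <= kappa / d%:R <= 1.
Proof.
move=> /andP[k0 kd]; rewrite divr_ge0 //=.
by case: d kd => [|d] kd; rewrite ?invr0 ?mulr0 // ler_pdivrMr // mul1r.
Qed.

(** Each coordinate contributes a factor 2 for the choice of block and a factor at most 2 for
    rounding, whence [4 ^+ d]. *)
Lemma box_count_le (R : realType) (d l j : nat) (kappa beta : R) :
  0 <= kappa <= d%:R -> beta = kappa / d%:R ->
  (2 ^ (d * (weight beta (l + j) - weight beta l).+1))%:R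
    <= 4 ^+ d * (2 ^+ j) `^ kappa :> R.
Proof.
move=> kd ->; have /andP[b0 _] := divd_ge0_le1 kd.
have -> : 4 ^+ d = 2 `^ (2 * d%:R) :> R.
  by rewrite powRrM !powR_mulrn //; congr (_ ^+ _); ring.
rewrite -powR_mulrn // -powRrM -powRD ?pnatr_eq0 ?implybT //.
rewrite natrX -powR_mulrn //; apply: ler_powR; first by rewrite ler1n.
rewrite natrM -natr1.
have -> : j%:R * kappa = d%:R * (j%:R * (kappa / d%:R)).
  by rewrite mulrCA mulr_divd.
by have := ler_wpM2l (ler0n R d) (weight_sub_le l j b0); lra.
Qed.

(* [pickle] numbers the pieces injectively; the factor 4 makes a ball of radius
   at most 1 meet a single piece. *)
Definition tuned_set (R : realType) (d : nat) (phi : R -> R) : set 'rV[R]_d :=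
  [set x | exists p L : nat, [/\ (0 < p)%N, (0 < L)%N &
    piece (phi (p%:R / (p + L)%:R) / d%:R) (4 * (pickle (p, L))%:R)
      (2 ^- (p + L)) L x]].

(** * Upper bound for the covering numbers of the union *)

Lemma ratio_itv (R : realType) (p L : nat) :
  (0 < p)%N -> (0 < L)%N -> 0 < (p%:R / (p + L)%:R : R) < 1.
Proof.
move=> p0 L0; rewrite divr_gt0 ?ltr0n ?addn_gt0 ?p0 //=.
by rewrite ltr_pdivrMr ?ltr0n ?addn_gt0 ?p0 // mul1r ltr_nat; lia.
Qed.

Lemma grid_point_itv (R : realType) (d p L : nat) (b : R) (n : 'I_d -> nat) i :
  (n i < 2 ^ L)%N ->
  b <= grid_point b (2 ^- (p + L)) n ord0 i < b + 1.
Proof.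
move=> nL; rewrite mxE lerDl mulr_ge0 ?invr_ge0 ?exprn_ge0 //=.
rewrite ltrD2l mulrC ltr_pdivrMr ?exprn_gt0 // mul1r.
rewrite -natrX ltr_nat (leq_trans nL) // leq_exp2l //; lia.
Qed.

(* In dimension [0] the pieces overlap, but then [x = y]. *)
Lemma tuned_set_local (R : realType) (d p L : nat) (phi : R -> R)
    (n : 'I_d -> nat) (x y : 'rV[R]_d) (beta b rho delta : R) :
  beta = phi (p%:R / (p + L)%:R) / d%:R ->
  b = 4 * (pickle (p, L))%:R -> rho = 2 ^- (p + L) ->
  (forall i, (n i < 2 ^ L)%N /\ digits_in (active beta) (n i)) ->
  x = grid_point b rho n -> delta <= 1 ->
  tuned_set phi y -> eball x delta y ->
  exists2 m : 'I_d -> nat, forall i, (m i < 2 ^ L)%N /\ digits_in (active beta) (m i)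
    & y = grid_point b rho m.
Proof.
move=> betaE bE rhoE nP xE d1 [p' [L' [p'0 L'0 [m mP yE]]]] xy.
case: d n nP x xE y xy m mP yE betaE => [|d] n nP x xE y xy m mP yE betaE.
  by exists n => //; apply/rowP; case.
suff PL : (p, L) = (p', L').
  by case: PL mP yE => <- <- mP yE; exists m; rewrite ?betaE ?bE ?rhoE.
apply: (pcan_inj pickleK).
have xy0 : `|y ord0 ord0 - x ord0 ord0| < 1.
  apply: lt_le_trans d1; apply: le_lt_trans xy.
  by have := enorm_coord (y - x) ord0; rewrite !mxE.
have xi := grid_point_itv p b (proj1 (nP ord0)).
have yi := grid_point_itv p' (4 * (pickle (p', L'))%:R : R) (proj1 (mP ord0)).
move: xi yi xy0; rewrite -rhoE -xE -yE bE ltr_norml.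
move: (pickle (p, L)) (pickle (p', L')) => k k' xi yi xy0.
case: (ltngtP k k') => // kk.
  have : k%:R + 1 <= (k'%:R : R) by rewrite natr1 ler_nat.
  by move=> kk1; exfalso; lra.
have : k'%:R + 1 <= (k%:R : R) by rewrite natr1 ler_nat.
by move=> kk1; exfalso; lra.
Qed.

(** [l] is the largest level at which [enorm_lt] fits a block of side [rho * 2 ^+ l] into a ball of
    radius [r]; if there is none, [l = 0] and every grid point gets its own ball. *)
Lemma dyadic_scale (R : realType) (d : nat) (rho r : R) :
  0 < rho -> 0 < r -> exists l : nat,
    (l = 0%N \/ d.+1%:R * (rho * 2 ^+ l) <= r) /\
    r < 2 * d.+1%:R * (rho * 2 ^+ l).
Proof.
move=> rho0 r0; have D0 : 0 < d.+1%:R * rho by rewrite mulr_gt0.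
have [y1|y1] := leP 1 (r / (d.+1%:R * rho)).
  have [l] := pow2_between y1.
  rewrite ler_pdivlMr // ltr_pdivrMr // exprS => /andP[lo hi].
  by exists l; split; [right|]; lra.
exists 0%N; split; first by left.
by move: y1; rewrite ltr_pdivrMr // expr0; lra.
Qed.

(** The constraint on [delta'] amounts to [delta' ^ theta <= delta], to be divided by [delta']; the
    factor [D >= 1] dominates its own power. *)
Lemma spectrum_scale_le (R : realType) (theta delta delta' D : R) :
  0 < theta < 1 -> 0 < delta -> 0 < delta' <= delta `^ (theta^-1) -> 1 <= D ->
  (D / delta') `^ (1 - theta) <= D * (delta / delta').
Proof.
move=> /andP[t0 t1] d0 d'le D1; have /andP[d'0 _] := d'le.
have D0 : 0 <= D by apply: le_trans D1.
rewrite powRM ?invr_ge0 ?(ltW d'0) //; apply: ler_pM; rewrite ?powR_ge0 //.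
  by apply: ler1_powR => //; lra.
rewrite -powR_inv1 ?(ltW d'0) // -powRrM mulN1r opprB.
have d'n : delta' != 0 by rewrite gt_eqF.
rewrite powRB ?d'n ?implybT // powR_inv1 ?(ltW d'0) // powRr1 ?(ltW d'0) //.
by rewrite ler_pM2r ?invr_gt0 // powR_theta_le.
Qed.

Lemma tuned_set_scale_le (R : realType) (d p L l : nat) (r : R) :
  (0 < p)%N -> (0 < L)%N -> 0 < r <= 1 ->
  r < 2 * d.+1%:R * (2 ^- (p + L) * 2 ^+ l) ->
  2 ^+ (L - l) <= (2 * d.+1%:R / r) `^ (1 - p%:R / (p + L)%:R).
Proof.
move=> p0 L0 /andP[r0 r1] rl; have /andP[_ c1] := ratio_itv R p0 L0.
have [Ll|lL] := leqP L l.
  move: Ll; rewrite -subn_eq0 => /eqP ->; rewrite expr0.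
  rewrite -[leLHS](powRr0 (2 * d.+1%:R / r)); apply: ler_powR; last lra.
  by rewrite ler_pdivlMr // mul1r -natrM; apply: le_trans r1 _; rewrite ler1n.
have pL0 : 0 < (p + L)%:R :> R by rewrite ltr0n addn_gt0 p0.
have cE : 1 - p%:R / (p + L)%:R = L%:R / (p + L)%:R :> R.
  by move: pL0; rewrite natrD => pL0; field; rewrite gt_eqF.
have le : 2 ^+ (p + L - l) <= 2 * d.+1%:R / r.
  rewrite ler_pdivlMr // mulrC -ler_pdivlMr ?exprn_gt0 //.
  rewrite exprB ?unitfE ?pnatr_eq0 //; last by lia.
  by rewrite invf_div [_ / _]mulrC ltW.
apply: le_trans (ge0_ler_powR _ _ _ le).
- rewrite -!powR_mulrn // -powRrM; apply: ler_powR; first by rewrite ler1n.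
  (* The inequality [(L - l) * (p + L) <= L * (p + L - l)] amounts to [0 <= l * p]. *)
  rewrite cE mulrA ler_pdivlMr // -!natrM ler_nat; nia.
- by rewrite cE divr_ge0.
- by rewrite nnegrE exprn_ge0.
- by rewrite nnegrE divr_ge0 // ltW.
Qed.

Lemma dist_lt_natr (R : realType) (m n k : nat) (rho b r : R) :
  0 < rho -> r <= rho * k%:R -> `|b + rho * m%:R - (b + rho * n%:R)| < r ->
  (m < n + k)%N /\ (n < m + k)%N.
Proof.
move=> rho0 rk; rewrite ltr_norml -!(ltr_nat R) !natrD => /andP[h1 h2].
split; rewrite -(ltr_pM2l rho0) mulrDr; lra.
Qed.

(** By [tuned_set_local] a single piece matters. If its break [c] is at most [theta], the ball
    confines each coordinate to a window of about [delta / delta'] blocks of level [l], and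
    [phi c <= phi theta]. If [theta < c], the whole piece is covered, and the decrease of
    [(1 - t) * phi t] compares the exponents. *)
Lemma tuned_set_covering_le (R : realType) (d : nat) (phi : R -> R)
    (phi_range : forall theta : R, 0 < theta < 1 -> 0 <= phi theta <= d%:R)
    (phi_incr : forall s t : R, 0 < s < 1 -> 0 < t < 1 -> s <= t ->
      phi s <= phi t)
    (phi_decr : forall s t : R, 0 < s < 1 -> 0 < t < 1 -> s <= t ->
      (1 - t) * phi t <= (1 - s) * phi s)
    (theta delta delta' : R) (x : 'rV[R]_d) :
  0 < theta < 1 -> 0 < delta <= 1 -> 0 < delta' <= delta `^ (theta^-1) ->
  tuned_set phi x ->
  (covering_number delta' (tuned_set phi `&` eball x delta)
    <= (4 ^+ d * (8 * d.+1%:R * (delta / delta')) `^ phi theta)%:E)%E.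
Proof.
move=> t01 d01 d'le [p [L [p0 L0 [n nP xE]]]].
have /andP[d0 d1] := d01; have /andP[d'0 d'd'] := d'le; have /andP[t0 t1] := t01.
have c01 := ratio_itv R p0 L0.
set c := p%:R / (p + L)%:R in nP c01.
set rho : R := 2 ^- (p + L) in xE.
set D : R := d.+1%:R; have D1 : 1 <= D by rewrite ler1n.
have rho0 : 0 < rho by rewrite invr_gt0 exprn_gt0.
have k0d := phi_range c c01; have /andP[k0 kd] := k0d.
have /andP[f0 fd] := phi_range theta t01.
have d'1 : delta' <= 1.
  by apply: le_trans d'd' _; apply: powR_le1; rewrite // invr_ge0 ltW.
have ratio1 : 1 <= delta / delta'.
  rewrite ler_pdivlMr // mul1r; apply: le_trans (powR_theta_le t0 d0 d'le).
  rewrite -[leLHS]powRr1 ?(ltW d'0) //.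
  by apply: ger_powR; rewrite ?d'0 // ltW.
have [l [lr rl]] := dyadic_scale d rho0 d'0.
have loc := tuned_set_local erefl erefl erefl nP xE d1.
suff [j [a [box jle]]] : exists j (a : 'I_d -> nat),
    (forall m : 'I_d -> nat, (forall i, (m i < 2 ^ L)%N) ->
      eball x delta (grid_point (4 * (pickle (p, L))%:R) rho m) ->
      forall i, (a i <= m i < a i + 2 ^ (l + j))%N) /\
    (2 ^+ j) `^ phi c <= (8 * D * (delta / delta')) `^ phi theta.
  apply: covering_number_le.
    apply: (covered_by_box (divd_ge0_le1 k0d) rho0 d'0 lr
      (b := 4 * (pickle (p, L))%:R) (a := a) (j := j)).
    move=> y [Fy xy]; have [m mP yE] := loc _ Fy xy.
    exists m => // i; have [mL Jm] := mP i; split => //.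
    by apply: box; [move=> i'; have [] := mP i' | rewrite -yE].
  apply: le_trans (box_count_le _ _ k0d erefl) _.
  by rewrite ler_pM2l ?exprn_gt0.
have B1 : 1 <= 8 * D * (delta / delta') by nra.
have [ct|tc] := leP c theta.
  have y1 : 1 <= 2 * D * (delta / delta') by nra.
  have [j /andP[jy yj]] := pow2_between y1.
  (* The window reaches [2 ^ (l + j.+1)] to both sides of [n i], hence [j.+2]; truncated subtraction
     stops it at [0]. *)
  exists j.+2, (fun i => n i - 2 ^ (l + j.+1))%N; split.
    move=> m _ xm i.
    have := le_lt_trans (enorm_coord _ i) xm; rewrite xE !mxE.
    have dk : delta <= rho * (2 ^ (l + j.+1))%:R.
      rewrite natrX exprD mulrA; move: yj; rewrite mulrA ltr_pdivrMr // => yj.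
      have := exprn_gt0 j.+1 (ltr0n R 2); set w := 2 ^+ j.+1 in yj * => w0.
      have : delta' * w < 2 * D * (rho * 2 ^+ l) * w by rewrite ltr_pM2r.
      nra.
    move=> /(dist_lt_natr rho0 dk)[]; rewrite [(l + j.+2)%N]addnS expnS.
    by move: (2 ^ (l + j.+1))%N (m i) (n i); clear; lia.
  (* The constant 8 comes from [2 ^+ j.+2 = 4 * 2 ^+ j] and [2 ^+ j <= 2 * D * (delta / delta')]. *)
  apply: le_trans (_ : (8 * D * (delta / delta')) `^ phi c <= _); last first.
    by apply: ler_powR => //; apply: phi_incr.
  apply: ge0_ler_powR; rewrite ?nnegrE ?exprn_ge0 //; first lra.
  by rewrite !exprS; lra.
exists (L - l)%N, (fun=> 0%N); split.
  move=> m mL _ i; rewrite add0n (leq_trans (mL i)) // leq_exp2l //.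
  by rewrite -maxnE leq_maxr.
have D2 : 1 <= 2 * D by lra.
have d'r : 0 < delta' <= 1 by rewrite d'0.
have B2 : 1 <= 2 * D / delta' by rewrite ler_pdivlMr // mul1r (le_trans d'1).
(* Raised to the power [phi c], the bound has exponent [(1 - c) * phi c], which is at most
   [(1 - theta) * phi theta]. *)
apply: le_trans (ge0_ler_powR k0 _ _ (tuned_set_scale_le p0 L0 d'r rl)) _.
- by rewrite nnegrE exprn_ge0.
- by rewrite nnegrE powR_ge0.
rewrite -powRrM; apply: le_trans (ler_powR B2 (phi_decr _ _ t01 c01 (ltW tc))) _.
rewrite powRrM; apply: ge0_ler_powR; rewrite ?nnegrE ?powR_ge0 //; first lra.
by apply: le_trans (spectrum_scale_le t01 d0 d'le D2) _; nra.
Qed.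

Lemma tuned_set_spectrum_exponent (R : realType) (d : nat) (phi : R -> R)
    (phi_range : forall theta : R, 0 < theta < 1 -> 0 <= phi theta <= d%:R)
    (phi_incr : forall s t : R, 0 < s < 1 -> 0 < t < 1 -> s <= t ->
      phi s <= phi t)
    (phi_decr : forall s t : R, 0 < s < 1 -> 0 < t < 1 -> s <= t ->
      (1 - t) * phi t <= (1 - s) * phi s) (theta : R) :
  0 < theta < 1 ->
  spectrum_exponent theta (tuned_set (d := d) phi) (phi theta).
Proof.
move=> t01; exists (4 ^+ d * (8 * d.+1%:R) `^ phi theta).
  by rewrite mulr_gt0 ?exprn_gt0 // powR_gt0 // mulr_gt0.
move=> delta d01 delta' d'le x Fx.
have := tuned_set_covering_le phi_range phi_incr phi_decr t01 d01 d'le Fx.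
have /andP[d0 _] := d01; have /andP[d'0 _] := d'le.
by rewrite powRM ?mulrA // ?divr_ge0 ?(ltW d0) ?(ltW d'0).
Qed.

(** * Lower bound for the exponents of the union *)

Lemma piece_covering_ge (R : realType) (d : nat) (A : set 'rV[R]_d)
    (beta b rho delta' : R) (L : nat) :
  0 <= beta <= 1 -> 0 < rho -> delta' <= rho / 2 ->
  (forall n : 'I_d -> nat,
     (forall i, (n i < 2 ^ L)%N /\ digits_in (active beta) (n i)) ->
     A (grid_point b rho n)) ->
  ((2 ^ (d * weight beta L))%:R%:E <= covering_number delta' A)%E.
Proof.
move=> b01 rho0 dr An.
pose S := numerals (active beta) L.
have sS : size S = (2 ^ weight beta L)%N.
  rewrite /S (_ : active beta = (fun i => active beta (0 + i))) //.
  rewrite size_numerals_active // add0n {2}/weight mul0r.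
  by rewrite truncn0 subn0.
pose f (t : {ffun 'I_d -> 'I_(size S)}) : 'rV[R]_d :=
  grid_point b rho (fun i => nth 0%N S (t i)).
have -> : (2 ^ (d * weight beta L))%N = #|{: {ffun 'I_d -> 'I_(size S)}}|.
  by rewrite card_ffun !card_ord sS -expnM mulnC.
(* Distinct grid points differ by at least [rho] in some coordinate, whereas two points of a ball of
   radius at most [rho / 2] differ by less than [rho] in each. *)
apply: (covering_number_ge (f := f)) => [t|t u c tc uc].
  by apply: An => i; apply: numerals_digits_in; apply: mem_nth.
apply/ffunP => i; apply/val_inj/eqP => /=.
rewrite -(nth_uniq 0%N (ltn_ord (t i)) (ltn_ord (u i)) (numerals_uniq _ _)) -/S.
have := le_lt_trans (enorm_coord _ i) tc; have := le_lt_trans (enorm_coord _ i) uc.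
rewrite !mxE => hu ht.
have r1 : rho <= rho * 1%:R by rewrite mulr1.
have := dist_lt_natr rho0 r1 (b := b) (m := nth 0%N S (t i)) (n := nth 0%N S (u i)).
suff h : `|b + rho * (nth 0%N S (t i))%:R - (b + rho * (nth 0%N S (u i))%:R)| < rho.
  by move=> /(_ h)[]; rewrite !addn1 !ltnS eqn_leq => -> ->.
by move: hu ht; rewrite !ltr_norml; lra.
Qed.

Lemma weight_active_ge (R : realType) (d : nat) (kappa : R) (L : nat) :
  0 <= kappa <= d%:R ->
  L%:R * kappa - d%:R <= (d * weight (kappa / d%:R) L)%:R.
Proof.
move=> kd; have /andP[b0 _] := divd_ge0_le1 kd.
have h : 0 <= L%:R * (kappa / d%:R) by rewrite mulr_ge0.
have /andP[_ wg] := truncn_itv h.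
rewrite natrM.
have -> : L%:R * kappa = d%:R * (L%:R * (kappa / d%:R)).
  by rewrite mulrCA mulr_divd.
have := ler_wpM2l (ler0n R d) (ltW wg); rewrite -natr1 -/(weight _ _); lra.
Qed.

Lemma powR2_unbounded (R : realType) (e K : R) :
  0 < e -> exists N0 : nat, forall N : nat, (N0 <= N)%N -> K < 2 `^ (N%:R * e).
Proof.
move=> e0; have [M KM] : exists M : nat, K < M%:R.
  by exists (Num.truncn K).+1; apply: truncnS_gt.
exists (Num.truncn (M%:R / e)).+1 => N NN.
apply: lt_le_trans KM _; apply: (@le_trans _ _ (2 `^ M%:R)).
  by rewrite powR_mulrn // -natrX ler_nat ltnW // ltn_expl.
apply: ler_powR; first by rewrite ler1n.
rewrite -ler_pdivrMr //; apply: le_trans (ltW (truncnS_gt _)) _.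
by rewrite ler_nat.
Qed.

(** If [alpha < phi theta], the piece with [p + L = N] needs at least about
    [2 ^ (N * (1 - theta) * phi theta)] balls, but the exponent allows only about
    [2 ^ (N * (1 - theta) * alpha)], which is absurd for large [N]. *)
Lemma tuned_set_exponent_ge (R : realType) (d : nat) (phi : R -> R)
    (phi_range : forall theta : R, 0 < theta < 1 -> 0 <= phi theta <= d%:R)
    (phi_decr : forall s t : R, 0 < s < 1 -> 0 < t < 1 -> s <= t ->
      (1 - t) * phi t <= (1 - s) * phi s) (theta alpha : R) :
  0 < theta < 1 ->
  spectrum_exponent theta (tuned_set (d := d) phi) alpha -> phi theta <= alpha.
Proof.
move=> t01 [C C0 HC]; have /andP[t0 t1] := t01; rewrite leNgt; apply/negP => lt.
set D : R := d.+1%:R; have D1 : 1 <= D by rewrite ler1n.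
have e0 : 0 < (1 - theta) * (phi theta - alpha) by rewrite mulr_gt0 ?subr_gt0.
(* The constant gathers all losses: [2 ^ d] from rounding the digit counts, [2 ^ |alpha|] from
   rounding [p], and the rest from the assumed bound. *)
have [N0 N0P] :=
  powR2_unbounded (C * (2 * D) `^ alpha * 2 `^ (d%:R + `|alpha|)) e0.
(* The second condition forces [d.+1 <= p], so that [delta = D * 2 ^- p] is at most 1. *)
have [N [NN0]] : exists N : nat, (N0 <= N)%N /\ (D + 1) / theta < N%:R.
  exists (maxn N0 (Num.truncn ((D + 1) / theta)).+1); rewrite leq_maxl; split=> //.
  by apply: lt_le_trans (truncnS_gt _) _; rewrite ler_nat leq_maxr.
have KN := N0P N NN0; rewrite ltr_pdivrMr // => ND.
have Nt0 : 0 <= N%:R * theta by lra.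
have /andP[pN Np] := truncn_itv Nt0.
set p := Num.truncn (N%:R * theta) in pN Np.
have Dp : (d.+1 <= p)%N.
  by rewrite -(ler_nat R) -/D; move: Np; rewrite -natr1; lra.
have p0 : (0 < p)%N by apply: leq_trans Dp.
have N1 : 0 < N%:R :> R by rewrite -(pmulr_lgt0 _ t0); lra.
have pltN : (p < N)%N by rewrite -(ltr_nat R); nra.
pose L := (N - p)%N; have L0 : (0 < L)%N by rewrite subn_gt0.
have pL : (p + L)%N = N by rewrite subnKC // ltnW.
have LE : L%:R = N%:R - p%:R :> R by rewrite natrB // ltnW.
have c01 := ratio_itv R p0 L0; rewrite pL in c01.
set c := p%:R / N%:R in c01.
(* Rounding [p] down keeps the break on the side of [theta] where [(1 - t) * phi t] is larger. *)
have ct : c <= theta by rewrite ler_pdivrMr // mulrC.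
have Lk : N%:R * (1 - theta) * phi theta <= L%:R * phi c.
  have -> : L%:R = N%:R * (1 - c) :> R.
    by rewrite LE /c mulrBr mulr1 mulrCA divff ?gt_eqF // mulr1.
  by rewrite -!mulrA ler_pM2l //; apply: phi_decr.
set rho : R := 2 ^- N; have rho0 : 0 < rho by rewrite invr_gt0 exprn_gt0.
set b : R := 4 * (pickle (p, L))%:R.
have inF (n : 'I_d -> nat) :
    (forall i, (n i < 2 ^ L)%N /\ digits_in (active (phi c / d%:R)) (n i)) ->
    tuned_set phi (grid_point b rho n).
  by move=> nP; exists p, L; split => //; exists n; rewrite pL.
(* The factor [D] makes the ball about the corner of the piece contain all of it. *)
pose delta := D * 2 ^- p.
have p2 : 0 < 2 ^- p :> R by rewrite invr_gt0 exprn_gt0.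
have d01 : 0 < delta <= 1.
  rewrite mulr_gt0 ?ltr0n //= ler_pdivrMr ?exprn_gt0 // mul1r.
  by rewrite -natrX ler_nat (leq_trans Dp) // ltnW // ltn_expl.
(* Admissible because [p <= N * theta] gives [rho ^ theta <= 2 ^- p <= delta]. *)
have d'le : 0 < rho / 2 <= delta `^ (theta^-1).
  rewrite divr_gt0 //=; apply: (@le_trans _ _ rho); first by lra.
  apply: powR_theta_inv_le => //; first by case/andP: d01.
  apply: (@le_trans _ _ (2 ^- p)); last by rewrite ler_peMl // ltW.
  rewrite /rho -!powR_invn // -powRrM; apply: ler_powR; first by rewrite ler1n.
  by rewrite mulNr lerN2.
have x0F := inF (fun=> 0%N) (fun i => conj (expn_gt0 2 L) (@digits_in0 _)).
have := HC delta d01 (rho / 2) d'le _ x0F.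
apply/negP; rewrite -ltNge.
apply: lt_le_trans (piece_covering_ge (A := _ `&` _) (b := b) (L := L)
  (divd_ge0_le1 (phi_range c c01)) rho0 (lexx _) _); last first.
  move=> n nP; split; first exact: inF.
  rewrite /eball /=; apply: enorm_lt => // i; rewrite !mxE mulr0 addr0 addrC addKr.
  rewrite ger0_norm ?mulr_ge0 ?(ltW rho0) // /rho -pL.
  rewrite mulrC ler_pdivrMr ?exprn_gt0 // exprD mulrA mulVf ?expf_neq0 ?pnatr_eq0 //.
  by rewrite mul1r -natrX ler_nat ltnW //; have [] := nP i.
rewrite lte_fin natrX.
have -> : delta / (rho / 2) = 2 * D * 2 ^+ L.
  rewrite /delta /rho -pL exprD; field.
  by rewrite !expf_neq0 ?pnatr_eq0.
rewrite powRM ?exprn_ge0 //; last by rewrite mulr_ge0.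
rewrite -!powR_mulrn // -powRrM.
apply: lt_le_trans (ler_powR _ (weight_active_ge L (phi_range c c01))); last first.
  by rewrite ler1n.
apply: lt_le_trans (ler_powR _ (_ : N%:R * (1 - theta) * phi theta - d%:R <= _)).
- rewrite mulrA.
  have -> : N%:R * (1 - theta) * phi theta - d%:R
     = N%:R * ((1 - theta) * (phi theta - alpha))
       - (d%:R + `|alpha|) + (N%:R * (1 - theta) * alpha + `|alpha|) by ring.
  rewrite powRD ?pnatr_eq0 ?implybT // powRB ?pnatr_eq0 ?implybT //.
  apply: le_lt_trans (_ : C * (2 * D) `^ alpha
      * 2 `^ (N%:R * (1 - theta) * alpha + `|alpha|) < _).
    rewrite ler_pM2l; last by rewrite mulr_gt0 // powR_gt0 // mulr_gt0 // ltr0n.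
    apply: ler_powR; first by rewrite ler1n.
    (* The excess of [L] over [N * (1 - theta)] lies between 0 and 1; [|alpha|] pays for it whatever
       the sign of [alpha]. *)
    have a1 := ler_norm alpha; have a2 := ler_norm (- alpha).
    rewrite normrN in a2; rewrite LE.
    move: Np; rewrite -natr1; nra.
  by rewrite ltr_pM2r ?powR_gt0 // ltr_pdivlMr ?powR_gt0.
- by rewrite ler1n.
- by rewrite lerD2r.
Qed.

(** * The exact spectrum of the union and the equivalence *)

Lemma tuned_set_spectrum (R : realType) (d : nat) (phi : R -> R)
    (phi_range : forall theta : R, 0 < theta < 1 -> 0 <= phi theta <= d%:R)
    (phi_incr : forall s t : R, 0 < s < 1 -> 0 < t < 1 -> s <= t ->
      phi s <= phi t)
    (phi_decr : forall s t : R, 0 < s < 1 -> 0 < t < 1 -> s <= t ->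
      (1 - t) * phi t <= (1 - s) * phi s) (theta : R) :
  0 < theta < 1 ->
  upper_assouad_spectrum theta (tuned_set (d := d) phi) = (phi theta)%:E.
Proof.
move=> t01; apply/eqP; rewrite eq_le; apply/andP; split.
  apply: ereal_inf_lbound; exists (phi theta) => //.
  exact: tuned_set_spectrum_exponent.
apply: le_ereal_inf_tmp => _ [alpha Halpha <-]; rewrite lee_fin.
exact: tuned_set_exponent_ge Halpha.
Qed.

Theorem corollaryC (R : realType) (d : nat) (phi : R -> R)
    (phi_range : forall theta : R, 0 < theta < 1 -> 0 <= phi theta <= d%:R) :
  [<->
    (* (a) *)
    exists F : set 'rV[R]_d, forall theta : R, 0 < theta < 1 ->
      upper_assouad_spectrum theta F = (phi theta)%:E;
    (* (b) *)
    (forall s t : R, 0 < s < 1 -> 0 < t < 1 -> s <= t -> phi s <= phi t) /\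
    (forall s t : R, 0 < s < 1 -> 0 < t < 1 -> s <= t ->
      (1 - t) * phi t <= (1 - s) * phi s);
    (* (c) *)
    exists G : set (R -> R),
      [/\ G !=set0,
          forall g, G g -> exists c kappa : R,
            [/\ 0 < c < 1, 0 <= kappa <= d%:R &
                forall theta : R, 0 < theta < 1 ->
                  g theta = profile c kappa theta / (1 - theta)] &
          forall theta : R, 0 < theta < 1 ->
            (phi theta)%:E = ereal_sup [set (g theta)%:E | g in G]]
  ].
Proof.
tfae.
- by case=> F HF; apply: spectrum_monotone HF => t /phi_range/andP[].
- exact: profile_sup.
(* The step from (c) to (a) passes through (b), since the set is built from [phi] and not from the
   given family. *)
- move=> [G [_ G_profile phi_sup]].
  have [phi_incr phi_decr] := profile_sup_monotone G_profile phi_sup.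
  by exists (tuned_set phi); apply: tuned_set_spectrum.
Qed.
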